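(* Let $U,V\subset\mathbb{R}^n$ be open sets and let $\psi\in C^\infty(U\times V)$ be a real-valued function that is analytic in $V$ about a point $p\in V$, with Taylor functions $c_s:U\to\mathbb{R}$. Suppose that for any $k\in\mathbb{N}$ there is a set of $k$ Taylor functions $c_s(x)$ which are locally linearly independent in $U$. Then $\psi$ has full rank almost everywhere in $U\times V$.
   Context: Analyticity: a smooth $\psi$ is analytic in $V$ about $p\in V$ if it has a Taylor expansion in $y\in V$: for all $x\in U$, $y\in V$, $\psi(x,y)=\sum_{m=0}^\infty\ \sum_{s:\,[s]=m} c_s(x)(y-p)^s$, where $s=(s_1,\dots,s_n)$ is a multi-index of non-negative integers, $[s]=s_1+\dots+s_n$, and $(y-p)^s=(y_1-p_1)^{s_1}\cdots(y_n-p_n)^{s_n}$. The functions $c_s$ are called the Taylor functions of $\psi$. Local linear independence: a collection of functions $f_s:U\to\mathbb{R}$ is locally linearly independent in $U$ if for any nonempty open subset $W$ of $U$, $\sum_s\alpha_sf_s(x)=0$ for almost all (Lebesgue) $x\in W$ only if $\alpha_s=0$ for all $s$. Full rank: $\psi:U\times V\to\mathbb{R}$ has full rank almost everywhere (a.e.) in $U\times V$ if for any $k\in\mathbb{N}$ and nonempty open sets $U_i\subset U$, $V_j\subset V$, $i,j=1,\dots,k$, we have $\mathrm{rank}(\{\psi(x_i,y_j)\}_{i,j=1}^{k})\le k$ for all $x_i\in U_i$, $y_j\in V_j$, with equality for at least one choice of the $x_i\in U_i$ and $y_j\in V_j$. *)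

(* Defs.v *)
From HB Require Import structures.
From mathcomp Require Import all_boot all_order all_algebra.
From mathcomp Require Import all_classical all_reals all_analysis.

Set Implicit Arguments.
Unset Strict Implicit.
Unset Printing Implicit Defensive.

Import Order.TTheory GRing.Theory Num.Theory.
Import numFieldNormedType.Exports.

Local Open Scope classical_set_scope.
Local Open Scope ring_scope.

(* Functions on subsets of R^n are represented by total functions on row
   vectors; every notion below only depends on their values on the subset. *)

(* All partial derivatives of order at most m exist and are continuous on the
   open set A. As A is open, these only depend on the restriction of f to A. *)
Fixpoint C_class (R : realType) (N m : nat) (A : set 'rV[R]_N)
    (f : 'rV[R]_N -> R) : Prop :=
  (forall x, A x -> {for x, continuous f}) /\
  if m is m'.+1 then
    forall i : 'I_N,
      (forall x, A x -> derivable f x (delta_mx 0 i)) /\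
      C_class m' A (fun x => 'D_(delta_mx 0 i) f x)
  else True.

Definition smooth (R : realType) (N : nat) (A : set 'rV[R]_N)
    (f : 'rV[R]_N -> R) : Prop :=
  forall m : nat, C_class m A f.

(* U x V is seen as a subset of R^(n + n). *)
Definition smooth2 (R : realType) (n : nat) (U V : set 'rV[R]_n)
    (psi : 'rV[R]_n -> 'rV[R]_n -> R) : Prop :=
  smooth [set z : 'rV[R]_(n + n) | U (lsubmx z) /\ V (rsubmx z)]
         (fun z => psi (lsubmx z) (rsubmx z)).

Definition multi_index (n : nat) := {ffun 'I_n -> nat}.

Definition mi_weight (n : nat) (s : multi_index n) : nat := (\sum_i s i)%N.

Definition mi_pow (R : realType) (n : nat) (v : 'rV[R]_n)
    (s : multi_index n) : R := \prod_i v 0 i ^+ s i.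

(* The inner sum ranges over a finite set of multi-indices; the series over m
   converges to psi x y in the sense of partial sums. *)
Definition taylor_expansion (R : realType) (n : nat) (U V : set 'rV[R]_n)
    (psi : 'rV[R]_n -> 'rV[R]_n -> R) (p : 'rV[R]_n)
    (c : multi_index n -> 'rV[R]_n -> R) : Prop :=
  forall x y, U x -> V y ->
    series (fun m : nat =>
      \sum_(s \in [set s : multi_index n | mi_weight s = m])
        (c s x * mi_pow (y - p) s)) @ \oo --> psi x y.

(* Lebesgue null sets of R^n: coverable by countably many boxes of arbitrarily
   small total volume. The set D of indices makes finite and empty families
   available, so that the empty set is null also when n = 0, where every box
   has volume 1. *)
Definition lebesgue_null (R : realType) (n : nat) (A : set 'rV[R]_n) : Prop :=
  forall e : R, 0 < e ->
  exists (D : set nat) (a b : nat -> 'rV[R]_n),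
    [/\ forall k i, a k 0 i <= b k 0 i,
        A `<=` \bigcup_(k in D) [set x | forall i, a k 0 i <= x 0 i <= b k 0 i]
      & (\esum_(k in D) (\prod_i (b k 0 i - a k 0 i))%:E < e%:E)%E].

Definition locally_linearly_independent (R : realType) (n : nat) (I : finType)
    (U : set 'rV[R]_n) (f : I -> 'rV[R]_n -> R) : Prop :=
  forall W : set 'rV[R]_n, open W -> W !=set0 -> W `<=` U ->
  forall alpha : I -> R,
    lebesgue_null (W `&` [set x | \sum_s alpha s * f s x <> 0]) ->
    forall s, alpha s = 0.

Definition full_rank_ae (R : realType) (n : nat) (U V : set 'rV[R]_n)
    (psi : 'rV[R]_n -> 'rV[R]_n -> R) : Prop :=
  forall (k : nat) (U_ V_ : 'I_k -> set 'rV[R]_n),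
    (forall i, [/\ open (U_ i), U_ i !=set0 & U_ i `<=` U]) ->
    (forall j, [/\ open (V_ j), V_ j !=set0 & V_ j `<=` V]) ->
    (forall x y : 'I_k -> 'rV[R]_n,
       (forall i, U_ i (x i)) -> (forall j, V_ j (y j)) ->
       (\rank (\matrix_(i, j) psi (x i) (y j)) <= k)%N) /\
    (exists x y : 'I_k -> 'rV[R]_n,
       [/\ forall i, U_ i (x i), forall j, V_ j (y j)
         & \rank (\matrix_(i, j) psi (x i) (y j)) = k]).

(* Main.v *)
Require Import Defs.
From HB Require Import structures.
From mathcomp Require Import all_boot all_order all_algebra.
From mathcomp Require Import all_classical all_reals all_analysis.
From mathcomp Require Import ring lra.

(** Two independent facts are combined.

    The first is linear algebra: if finitely many functions f_1, ..., f_k are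
    linearly independent on each of the sets W_1, ..., W_k, one can choose
    x_i in W_i making the matrix (f_j (x_i)) invertible, because a proper row
    space is annihilated by some nonzero column alpha, and independence gives
    a point of the next set where sum_j alpha_j f_j does not vanish
    ([exists_full_rank]). It is applied twice: to k Taylor functions and the
    U_i, which gives points x_i, and then to the slices psi(x_i, .) and the
    V_j, which gives points y_j.

    The second fact says why these slices are independent on every nonempty
    open part of V: a combination sum_i beta_i psi(x_i, .) vanishing there has
    all its Taylor coefficients sum_i beta_i c_s(x_i) equal to zero
    ([slices_independent]), and (c_s(x_i)) is invertible for the chosen
    multi-indices s. As V need be neither connected nor star-shaped, the
    vanishing is transported to p along rays: for v = y - p the function
    t |-> psi(x, p + t v) is given near t = 1 by the power series in t whose
    coefficients are the homogeneous parts of the expansion at v, and this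
    series converges beyond t = 1. So everything reduces to one statement
    about a single real variable ([power_series_eq0]): a power series with sum
    zero near t = 1 has all its coefficients equal to zero. Scaling all
    coordinates at once isolates the homogeneous parts; scaling one coordinate
    at a time then isolates the monomials inside each of them.

    The one-variable statement is proved in the Hardy space of square-summable
    coefficient sequences. Dividing f by the Blaschke factor
    (t - a) / (1 - a t) at a zero a of f in ]0, 1[ does not increase the sum
    of the squared coefficients, and f(0) = - a h(0) for the quotient h. With
    N zeros in ]0, rho] this yields f(0)^2 <= rho^(2N) C, so f(0) = 0 as soon
    as there are infinitely many zeros below some rho < 1; dividing by powers
    of t kills the other coefficients. *)

Set Implicit Arguments.
Unset Strict Implicit.
Unset Printing Implicit Defensive.

Import Order.TTheory GRing.Theory Num.Theory.
Import numFieldNormedType.Exports.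

Local Open Scope classical_set_scope.
Local Open Scope ring_scope.

(** * Square-summable power series and Blaschke quotients *)

Lemma sumr_geometric_le (R : realFieldType) (a : R) (n N : nat) :
  0 <= a < 1 -> (n <= N)%N ->
  \sum_(n <= j < N) a ^+ j <= a ^+ n / (1 - a).
Proof.
move=> /andP[a0 a1] nN.
rewrite ler_pdivlMr ?subr_gt0//.
have -> : (\sum_(n <= j < N) a ^+ j) * (1 - a) = a ^+ n - a ^+ N.
  rewrite -[RHS]opprB -(telescope_sumr (fun j => a ^+ j) nN) -sumrN.
  rewrite big_distrl /=.
  by apply: eq_bigr => j _; rewrite exprS; ring.
by rewrite gerBl exprn_ge0.
Qed.

Lemma sqr_cvg0 (R : realType) (f : nat -> R) :
  (fun n => f n ^+ 2) @ \oo --> (0 : R) -> f @ \oo --> (0 : R).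
Proof.
move=> f2; apply/cvgrPdist_lt => e e0.
have /cvgrPdist_lt/(_ (e ^+ 2)) := f2; rewrite exprn_gt0// => /(_ isT).
apply: filterS => n; rewrite !sub0r !normrN normrX.
by rewrite ltr_pXn2r// nnegrE ltW.
Qed.

(** The squared norm of f in the Hardy space is at most C; stating it on partial
    sums avoids carrying a convergence hypothesis. *)
Definition energy_le (R : realType) (f : nat -> R) (C : R) :=
  forall N, \sum_(0 <= m < N) f m ^+ 2 <= C.

Lemma energy_le_cvg0 (R : realType) (f : nat -> R) (C : R) :
  energy_le f C -> f @ \oo --> (0 : R).
Proof.
move=> fC; apply: sqr_cvg0; apply: cvg_series_cvg_0.
apply: nondecreasing_is_cvgn.
  apply/nondecreasing_seqP => N.
  by rewrite /series /= big_nat_recr//= lerDl sqr_ge0.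
by exists C => _ [N _ <-]; exact: fC.
Qed.

Definition vanishes_at (R : realType) (f : nat -> R) (t : R) :=
  series (fun m => f m * t ^+ m) @ \oo --> (0 : R).

(** The coefficients of f(t) / (t - a), shifted by one: the coefficient of t^n is
    at index n + 1, which puts a 0 at index 0 and makes the recurrence
    f_n = g_(n-1) - a g_n uniform in n. *)
Definition root_quotient (R : realType) (f : nat -> R) (a : R) (n : nat) : R :=
  - (\sum_(0 <= m < n) f m * a ^+ m) / a ^+ n.

(** The coefficients of f(t) (1 - a t) / (t - a). *)
Definition blaschke_quotient (R : realType) (f : nat -> R) (a : R) (n : nat) :=
  root_quotient f a n.+1 - a * root_quotient f a n.

Lemma root_quotient0 (R : realType) (f : nat -> R) (a : R) :
  root_quotient f a 0 = 0.
Proof. by rewrite /root_quotient big_nil oppr0 mul0r. Qed.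

Lemma root_quotientE (R : realType) (f : nat -> R) (a : R) n : a != 0 ->
  f n = root_quotient f a n - a * root_quotient f a n.+1.
Proof.
move=> a0; rewrite /root_quotient big_nat_recr//= exprS.
by field; rewrite expf_neq0 a0.
Qed.

(** Since f(a) = 0, the initial segment of the series at a that defines the
    quotient is the opposite of the tail, and the tail from n on is at most
    a^n / (1 - a) times the supremum of the |f_m| with n <= m. *)
Lemma root_quotient_cvg0 (R : realType) (f : nat -> R) (a : R) :
  0 < a < 1 -> f @ \oo --> (0 : R) -> vanishes_at f a ->
  root_quotient f a @ \oo --> (0 : R).
Proof.
move=> /andP[a0 a1] f0 fa; apply/cvgrPdist_le => e e0.
have c0 : 0 < e * (1 - a) by rewrite mulr_gt0// subr_gt0.
have /cvgrPdist_le/(_ _ c0) [n0 _ fn0] := f0.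
exists n0 => // n /= n0n; rewrite sub0r normrN /root_quotient mulNr normrN.
rewrite normrM normfV (ger0_norm (exprn_ge0 n (ltW a0))).
rewrite ler_pdivrMr ?exprn_gt0//.
pose S N := \sum_(0 <= m < N) f m * a ^+ m.
have tail N : (n <= N)%N -> `|S n - S N| <= e * a ^+ n.
  move=> nN; rewrite /S (@big_cat_nat _ _ _ n 0 N)//= opprD addNKr normrN.
  apply: le_trans (ler_norm_sum _ _ _) _.
  apply: (@le_trans _ _ (\sum_(n <= m < N) e * (1 - a) * a ^+ m)).
    rewrite big_nat_cond [leRHS]big_nat_cond.
    apply: ler_sum => m /andP[/andP[nm _] _].
    rewrite normrM (ger0_norm (exprn_ge0 m (ltW a0))).
    rewrite ler_wpM2r ?exprn_ge0 ?(ltW a0)//.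
    by have := fn0 m (leq_trans n0n nm); rewrite sub0r normrN.
  rewrite -big_distrr/= -mulrA ler_pM2l//.
  rewrite mulrC -ler_pdivlMr ?subr_gt0//.
  by apply: sumr_geometric_le; rewrite // ltW.
have Sn : (fun N => `|S n - S N|) @ \oo --> `|S n - 0|.
  by apply: cvg_norm; apply: cvgB => //; exact: cvg_cst.
rewrite subr0 in Sn; apply: (cvgr_to_le Sn).
by exists n.
Qed.

Lemma blaschke_quotient_head (R : realType) (f : nat -> R) (a : R) : a != 0 ->
  f 0 = - a * blaschke_quotient f a 0.
Proof.
move=> a0; rewrite (root_quotientE f 0 a0) /blaschke_quotient root_quotient0.
ring.
Qed.

(** The Blaschke factor has modulus one on the unit circle, hence multiplying by
    it preserves the Hardy norm: on partial sums only a boundary term is left. *)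
Lemma blaschke_quotient_energyE (R : realType) (f : nat -> R) (a : R) N :
  a != 0 ->
  \sum_(0 <= m < N) blaschke_quotient f a m ^+ 2 =
  \sum_(0 <= m < N) f m ^+ 2 + (1 - a ^+ 2) * root_quotient f a N ^+ 2.
Proof.
move=> a0; elim: N => [|N IH]; first by rewrite !big_nil root_quotient0; ring.
rewrite !(big_nat_recr N)//= IH (root_quotientE f N a0) /blaschke_quotient.
ring.
Qed.

Lemma blaschke_quotient_seriesE (R : realType) (f : nat -> R) (a t : R) N :
  a != 0 ->
  (t - a) * (\sum_(0 <= m < N) blaschke_quotient f a m * t ^+ m) =
  (1 - a * t) * (\sum_(0 <= m < N) f m * t ^+ m)
  + (1 - a ^+ 2) * (root_quotient f a N * t ^+ N).
Proof.
move=> a0; elim: N => [|N IH]; first by rewrite !big_nil root_quotient0; ring.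
rewrite !(big_nat_recr N)//= mulrDr IH (root_quotientE f N a0).
rewrite /blaschke_quotient (exprS t N); ring.
Qed.

(** The boundary term of the energy identity tends to 0, and the partial sums of
    squares are nondecreasing, so the bound passes to each of them. *)
Lemma blaschke_quotient_energy_le (R : realType) (f : nat -> R) (a C : R) :
  0 < a < 1 -> vanishes_at f a -> energy_le f C ->
  energy_le (blaschke_quotient f a) C.
Proof.
move=> /[dup] a01 /andP[a0 a1] fa fC N.
have G0 := root_quotient_cvg0 a01 (energy_le_cvg0 fC) fa.
have lim : (fun n => C + (1 - a ^+ 2) * root_quotient f a n ^+ 2) @ \oo
    --> C + (1 - a ^+ 2) * 0 ^+ 2.
  apply: cvgD; first exact: cvg_cst.
  by apply: cvgMr; rewrite expr2; apply: cvgM.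
rewrite expr0n mulr0 addr0 in lim; apply: (cvgr_to_ge lim).
exists N => // n /= Nn.
apply: (@le_trans _ _ (\sum_(0 <= m < n) blaschke_quotient f a m ^+ 2)).
  rewrite (@big_cat_nat _ _ _ N 0 n)//= lerDl; apply: sumr_ge0 => i _; exact: sqr_ge0.
by rewrite blaschke_quotient_energyE ?gt_eqF// lerD2r.
Qed.

Lemma blaschke_quotient_vanishes (R : realType) (f : nat -> R) (a t C : R) :
  0 < a < 1 -> vanishes_at f a -> energy_le f C ->
  `|t| < 1 -> t != a -> vanishes_at f t ->
  vanishes_at (blaschke_quotient f a) t.
Proof.
move=> /[dup] a01 /andP[a0 a1] fa fC t1 ta ft.
have G0 := root_quotient_cvg0 a01 (energy_le_cvg0 fC) fa.
rewrite /vanishes_at.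
have -> : series (fun m => blaschke_quotient f a m * t ^+ m) =
  (fun N => (t - a)^-1 * ((1 - a * t) * series (fun m => f m * t ^+ m) N
  + (1 - a ^+ 2) * (root_quotient f a N * t ^+ N))).
  apply/funext => N; rewrite /series /= -blaschke_quotient_seriesE ?gt_eqF//.
  by rewrite mulKf// subr_eq0.
have -> : (0 : R) =
    (t - a)^-1 * ((1 - a * t) * 0 + (1 - a ^+ 2) * (0 * 0)) by ring.
apply: cvgMr; apply: cvgD; first exact: cvgMr.
apply: cvgMr; apply: cvgM => //; exact: cvg_expr.
Qed.

(** Each zero a that is divided out contributes a factor a^2 <= rho^2, while the
    energy bound C is inherited by the quotient. *)
Lemma energy_zeros_le (R : realType) (f : nat -> R) (C rho : R) (z : seq R) :
  rho < 1 -> uniq z -> {in z, forall a, 0 < a <= rho} ->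
  energy_le f C -> {in z, forall a, vanishes_at f a} ->
  f 0 ^+ 2 <= rho ^+ (2 * size z) * C.
Proof.
move=> rho1; elim: z f => [|a z IH] f /=.
  by move=> _ _ fC _; have := fC 1; rewrite big_nat1 muln0 expr0 mul1r.
move=> /andP[az uz] zrho fC fz.
have /andP[a0 arho] := zrho a (mem_head _ _).
have a01 : 0 < a < 1 by rewrite a0 (le_lt_trans arho).
have fa := fz a (mem_head _ _).
have IH' : blaschke_quotient f a 0 ^+ 2 <= rho ^+ (2 * size z) * C.
  apply: IH => //.
  - by move=> b bz; apply: zrho; rewrite inE bz orbT.
  - exact: blaschke_quotient_energy_le.
  - move=> b bz.
    have bz' : b \in a :: z by rewrite inE bz orbT.
    have /andP[b0 brho] := zrho b bz'.
    apply: (blaschke_quotient_vanishes (C := C)) => //.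
    + by rewrite gtr0_norm// (le_lt_trans brho).
    + by apply: contraNneq az => <-.
    + exact: fz.
rewrite (blaschke_quotient_head f (lt0r_neq0 a0)) mulnS exprD.
rewrite exprMn sqrrN -mulrA.
apply: ler_pM => //; rewrite ?sqr_ge0//.
by rewrite ler_pXn2r ?nnegrE// ltW// (lt_le_trans a0).
Qed.

(** The constant coefficient is zero since rho^(2N) tends to 0. The smallest index
    of a nonzero coefficient is then ruled out by factoring out that power of t,
    which keeps all the z i as zeros because they are not 0. *)
Lemma energy_infinite_zeros (R : realType) (f : nat -> R) (C rho : R)
    (z : nat -> R) :
  rho < 1 -> injective z -> (forall i, 0 < z i <= rho) ->
  energy_le f C -> (forall i, vanishes_at f (z i)) ->
  forall m, f m = 0.
Proof.
move=> rho1 zinj zrho.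
have rho0 : 0 < rho by have /andP[/lt_le_trans] := zrho 0; apply.
have head g : energy_le g C -> (forall i, vanishes_at g (z i)) -> g 0 = 0.
  move=> gC gz; apply/eqP; rewrite -sqrf_eq0; apply/eqP/le_anti.
  rewrite sqr_ge0 andbT.
  have lim : (fun N => (rho ^+ 2) ^+ N * C) @ \oo --> 0 * C.
    apply: cvgMl; apply: cvg_expr.
    by rewrite ger0_norm ?sqr_ge0// expr_lt1// ltW.
  rewrite mul0r in lim; apply: (cvgr_to_ge lim); near=> N.
  have := @energy_zeros_le _ g C rho (map z (iota 0 N)) rho1.
  rewrite map_inj_uniq// iota_uniq size_map size_iota exprM; apply=> //.
  - by move=> _ /mapP[i _ ->].
  - by move=> _ /mapP[i _ ->].
move=> fC fz m; elim/ltn_ind: m => m fm0.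
rewrite -[m]add0n; apply: (head (fun j => f (j + m)%N)) => [N|i].
  apply: le_trans (fC (m + N)%N).
  rewrite (@big_cat_nat _ _ _ m 0 (m + N))//= ?leq_addr//.
  rewrite -[X in \sum_(X <= _ < m + N) _]add0n big_addn addKn lerDr.
  by apply: sumr_ge0 => ? _; exact: sqr_ge0.
have /andP[zi0 _] := zrho i.
rewrite /vanishes_at.
have -> : series (fun j => f (j + m)%N * z i ^+ j) =
   (fun N => z i ^- m * series (fun j => f j * z i ^+ j) (N + m)%N).
  apply/funext => N; rewrite /series /= addnC (@big_cat_nat _ _ _ m 0 (m + N))//= ?leq_addr//.
  have -> : \sum_(0 <= j < m) f j * z i ^+ j = 0.
    rewrite big_nat_cond big1// => j /andP[/andP[_ jm] _].
    by rewrite fm0// mul0r.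
  rewrite add0r.
  rewrite -[X in \sum_(X <= _ < m + N) _]add0n big_addn addKn big_distrr/=.
  apply: eq_bigr => j _; rewrite exprD.
  by field; rewrite expf_neq0// gt_eqF.
rewrite -[X in _ --> X](mulr0 (z i ^- m)); apply: cvgMr.
by apply: (cvg_comp (addn^~ m)); [exact: cvg_addnr|exact: fz].
Unshelve. all: by end_near. Qed.

(** Let 1 < r < r2 be points where the series converges. The terms are bounded at
    r2, so the rescaled coefficients f_m r^m decay geometrically and are
    square-summable; the zeros of f near 1 become zeros of the rescaled series
    near 1 / r < 1. *)
Lemma power_series_eq0 (R : realType) (f : nat -> R) :
  (\forall t \near (1 : R), vanishes_at f t) -> forall m, f m = 0.
Proof.
move=> /nbhs_ballP[e /= e0 fe].
pose d : R := Num.min e 1 / 4.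
have d0 : 0 < d by rewrite divr_gt0// lt_min e0 ltr01.
have de : 4 * d <= e by rewrite /d mulrC divfK// ge_min lexx.
have d1 : 4 * d <= 1 by rewrite /d mulrC divfK// ge_min lexx orbT.
have near1 t : `|t - 1| <= 2 * d -> vanishes_at f t.
  move=> td; apply: fe; rewrite /ball/= distrC; apply: le_lt_trans td _.
  by lra.
pose r := 1 + d; pose r2 := 1 + 2 * d.
have r0 : 0 < r by rewrite /r; lra.
have r20 : 0 < r2 by rewrite /r2; lra.
have [K Kf] : exists K, forall m, `|f m * r2 ^+ m| <= K.
  have /cvg_series_bounded : cvgn (series (fun m => f m * r2 ^+ m)).
    apply: cvgP; apply: near1; rewrite /r2 addrC addKr ger0_norm; lra.
  move=> [K [_ KP]].
  by exists (K + 1) => m; apply: (KP (K + 1)); rewrite ?ltrDl.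
pose q := r / r2.
have q01 : 0 <= q < 1.
  by rewrite /q divr_ge0 ?ltW//= ltr_pdivrMr// mul1r /r /r2; lra.
pose F m := f m * r ^+ m.
have FC : energy_le F (K ^+ 2 * ((q ^+ 2) ^+ 0 / (1 - q ^+ 2))).
  move=> N; have := @sumr_geometric_le _ (q ^+ 2) 0 N; rewrite sqr_ge0.
  have /andP[q0 q1] := q01; rewrite expr_lt1// => /(_ q1 (leq0n _)).
  move=> /(ler_wpM2l (sqr_ge0 K)); apply: le_trans.
  rewrite big_distrr/=; apply: ler_sum => m _.
  have -> : F m = (f m * r2 ^+ m) * q ^+ m.
    by rewrite /F /q expr_div_n; field; rewrite expf_neq0// gt_eqF.
  rewrite exprMn -!exprM mulnC ler_wpM2r ?exprn_ge0//.
  rewrite -real_normK ?num_real// ler_pXn2r ?nnegrE//.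
  exact: le_trans (Kf 0).
(* infinitely many distinct zeros of f in [1 - d, 1[, rescaled *)
pose z (i : nat) := (1 - d / i.+1%:R) / r.
have F0 : forall m, F m = 0.
  apply: (@energy_infinite_zeros _ F _ r^-1 z) FC _.
  - by rewrite invf_lt1// /r; lra.
  - move=> i j; rewrite /z => /(mulIf (invr_neq0 (lt0r_neq0 r0))).
    move=> /addrI/oppr_inj/(mulfI (lt0r_neq0 d0))/invr_inj/eqP.
    by rewrite eqr_nat => /eqP[].
  - move=> i; have h1 : 0 < d / i.+1%:R by rewrite divr_gt0.
    have h2 : d / i.+1%:R <= d.
      by rewrite ler_piMr ?(ltW d0)// invf_le1// ler1n.
    have h3 : 0 < 1 - d / i.+1%:R by rewrite subr_gt0 (le_lt_trans h2)//; lra.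
    rewrite /z divr_gt0//= ler_piMl ?invr_ge0 ?(ltW r0)//.
    by rewrite gerBl ltW.
  - move=> i; have h2 : 0 < d / i.+1%:R by rewrite divr_gt0.
    have h1 : d / i.+1%:R <= d.
      by rewrite ler_piMr ?(ltW d0)// invf_le1// ler1n.
    rewrite /vanishes_at.
    have -> : (fun m => F m * z i ^+ m) =
        (fun m => f m * (1 - d / i.+1%:R) ^+ m).
      apply/funext => m; rewrite /F /z expr_div_n.
      by field; rewrite expf_neq0// gt_eqF.
    apply: near1; rewrite addrAC subrr add0r normrN gtr0_norm//.
    by apply: le_trans h1 _; lra.
move=> m; have /eqP := F0 m.
by rewrite /F mulf_eq0 (gt_eqF (exprn_gt0 m r0)) orbF => /eqP.
Qed.

(** * Separating the monomials of a vanishing expansion *)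

Lemma near1_line (R : realType) (n : nat) (W : set 'rV[R]_n) (v u : 'rV[R]_n) :
  open W -> W v -> \forall t \near (1 : R), W (v + (t - 1) *: u).
Proof.
move=> oW Wv.
have lim : v + (t - 1) *: u @[t --> (1 : R)] --> v + (1 - 1) *: u.
  apply: cvgD; first exact: cvg_cst.
  by apply: cvgZl; apply: cvgB; [exact: cvg_id|exact: cvg_cst].
rewrite subrr scale0r addr0 in lim; apply: lim.
exact: open_nbhs_nbhs.
Qed.

Lemma mi_pow_scale (R : realType) (n : nat) (v : 'rV[R]_n) (s : multi_index n)
    (t : R) :
  mi_pow (t *: v) s = t ^+ mi_weight s * mi_pow v s.
Proof.
rewrite /mi_pow /mi_weight expr_sum -big_split/=.
by apply: eq_bigr => i _; rewrite mxE exprMn.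
Qed.

(** Multiplication of the i-th coordinate by t, written as a move along a line so
    that it stays in an open set for t near 1. *)
Lemma mi_pow_scale_coord (R : realType) (n : nat) (v : 'rV[R]_n)
    (s : multi_index n) (i : 'I_n) (t : R) :
  mi_pow (v + (t - 1) *: (v 0 i *: delta_mx 0 i)) s = t ^+ s i * mi_pow v s.
Proof.
rewrite /mi_pow (bigD1 i)//= [in RHS](bigD1 i)//= mulrA; congr (_ * _).
  rewrite -exprMn !mxE !eqxx/=; congr (_ ^+ _).
  by rewrite mulr1 mulrBl mul1r addrC subrK.
by apply: eq_bigr => j ji; rewrite !mxE (negPf ji) andbF !mulr0 addr0.
Qed.

(** Move along the line whose direction is supported by the zero coordinates. *)
Lemma open_nonzero_coords (R : realType) (n : nat) (W : set 'rV[R]_n) :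
  open W -> W !=set0 -> exists2 v, W v & forall i, v 0 i != 0.
Proof.
move=> oW [v Wv].
have := near1_line (\row_i (v 0 i == 0)%:R) oW Wv.
move=> /nbhs_ballP[e /= e0 eW].
exists (v + (1 + e / 2 - 1) *: \row_i (v 0 i == 0)%:R).
  apply: eW; rewrite /ball/= opprD addrA subrr add0r normrN gtr0_norm; lra.
move=> i; rewrite !mxE; have [vi|vi] := eqVneq (v 0 i) 0; last by rewrite mulr0 addr0.
by rewrite vi add0r mulr1 gt_eqF//; lra.
Qed.

(** Multiplying the i-th coordinate by t turns the sum into a polynomial in t whose
    coefficient of t^e collects the monomials of degree e in that coordinate; it
    vanishes for t near 1. *)
Lemma monomials_coord_eq0 (R : realType) (n : nat) (W : set 'rV[R]_n)
    (r : seq (multi_index n)) (Q : pred (multi_index n))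
    (d : multi_index n -> R) (i : 'I_n) (e : nat) :
  open W ->
  (forall v, W v -> \sum_(s <- r | Q s) d s * mi_pow v s = 0) ->
  forall v, W v -> \sum_(s <- r | Q s && (s i == e)) d s * mi_pow v s = 0.
Proof.
move=> oW HQ v Wv.
pose f e := \sum_(s <- r | Q s && (s i == e)) d s * mi_pow v s.
apply: (@power_series_eq0 _ f).
have := near1_line (v 0 i *: delta_mx 0 i) oW Wv.
apply: filterS => t /HQ Ht.
apply: cvg_near_cst; exists (\max_(s <- r) s i).+1 => // N /= maxN.
rewrite -[RHS]Ht /series /=.
under eq_bigr => e0 _ do rewrite /f big_mkcondr/= big_distrl/=.
rewrite exchange_big/= big_seq_cond [RHS]big_seq_cond.
apply: eq_bigr => s /andP[sr _].
rewrite mi_pow_scale_coord mulrCA mulrC.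
under eq_bigr => e0 _ do rewrite eq_sym (fun_if (fun z => z * t ^+ e0)) mul0r.
rewrite -big_mkcond/= big_nat1_eq/= ifT; first exact: mulrC.
by apply: leq_ltn_trans maxN; exact: leq_bigmax_seq.
Qed.

(** Fixing the degree in one coordinate after the other ends with the single
    monomial s0, which is nonzero at a point with nonzero coordinates. *)
Lemma monomials_eq0 (R : realType) (n : nat) (W : set 'rV[R]_n)
    (r : seq (multi_index n)) (d : multi_index n -> R) :
  open W -> W !=set0 -> uniq r ->
  (forall v, W v -> \sum_(s <- r) d s * mi_pow v s = 0) ->
  {in r, forall s, d s = 0}.
Proof.
move=> oW W0 ur Hr s0 s0r.
have Hl (l : seq 'I_n) v : W v ->
    \sum_(s <- r | all (fun i => s i == s0 i) l) d s * mi_pow v s = 0.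
  elim: l v => [|i l IH] v Wv; first exact: Hr.
  rewrite -[RHS](monomials_coord_eq0 i (s0 i) oW IH Wv).
  by apply: eq_bigl => s /=; rewrite andbC.
have [v Wv vN0] := open_nonzero_coords oW W0.
have := Hl (enum 'I_n) v Wv.
rewrite (eq_bigl (pred1 s0)); last first.
  move=> s /=; apply/allP/eqP => [ss0|-> //].
  by apply/ffunP => i; apply/eqP/ss0; rewrite mem_enum.
rewrite -big_filter filter_pred1_uniq// big_seq1 => /eqP.
rewrite mulf_eq0 => /orP[/eqP //|].
rewrite /mi_pow prodf_seq_eq0 => /hasP[i _] /=.
by rewrite expf_eq0 (negPf (vN0 i)) andbF.
Qed.

(** * The expansion of a combination of slices *)

Lemma finite_mi_weight n m : finite_set [set s : multi_index n | mi_weight s = m].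
Proof.
pose F (g : {ffun 'I_n -> 'I_m.+1}) : multi_index n := [ffun i => val (g i)].
apply: (@sub_finite_set _ _ (F @` setT)); last first.
  by apply: finite_image; exact: finite_finset.
move=> s /= sm; exists [ffun i => inord (s i)] => //.
apply/ffunP => i; rewrite !ffunE /= inordK// ltnS -sm /mi_weight.
by rewrite (bigD1 i)//= leq_addr.
Qed.

Definition homogeneous_part (R : realType) (n : nat)
    (d : multi_index n -> R) (v : 'rV[R]_n) (m : nat) : R :=
  \sum_(s \in [set s : multi_index n | mi_weight s = m]) (d s * mi_pow v s).

Lemma homogeneous_partE (R : realType) (n : nat) (d : multi_index n -> R)
    (v : 'rV[R]_n) (m : nat) :
  homogeneous_part d v m =
  \sum_(s <- finmap.enum_fset (fset_set [set s : multi_index n | mi_weight s = m]))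
    d s * mi_pow v s.
Proof. by rewrite /homogeneous_part fsbig_finite//; exact: finite_mi_weight. Qed.

Lemma homogeneous_part_scale (R : realType) (n : nat) (d : multi_index n -> R)
    (v : 'rV[R]_n) (m : nat) (t : R) :
  homogeneous_part d (t *: v) m = homogeneous_part d v m * t ^+ m.
Proof.
rewrite !homogeneous_partE big_distrl/= big_seq [RHS]big_seq.
apply: eq_bigr => s; rewrite in_fset_set; last exact: finite_mi_weight.
rewrite inE/= mi_pow_scale => ->; ring.
Qed.

(** Along the ray p + t (y - p) the expansion is a power series in t, so each
    homogeneous part vanishes on an open set, and so do its coefficients. *)
Lemma homogeneous_series_eq0 (R : realType) (n : nat) (p : 'rV[R]_n)
    (W : set 'rV[R]_n) (d : multi_index n -> R) :
  open W -> W !=set0 ->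
  (forall y, W y -> series (homogeneous_part d (y - p)) @ \oo --> (0 : R)) ->
  forall s, d s = 0.
Proof.
move=> oW [y0 Wy0] dW s.
pose W' := (fun v => v + p) @^-1` W.
have oW' : open W'.
  apply: open_comp oW => v _.
  apply: (@cvgD _ _ _ (nbhs v) _ id (cst p) v p); first exact: cvg_id.
  exact: cvg_cst.
have W'0 : W' !=set0 by exists (y0 - p); rewrite /W' /= subrK.
pose r := finmap.enum_fset
  (fset_set [set s' : multi_index n | mi_weight s' = mi_weight s]).
have : {in r, forall s, d s = 0}.
  apply: (monomials_eq0 oW' W'0); first exact: finmap.fset_uniq.
  move=> v W'v; rewrite -homogeneous_partE.
  apply: (@power_series_eq0 _ (homogeneous_part d v)).
  have := near1_line v oW' W'v; apply: filterS => t.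
  rewrite scalerBl scale1r addrC subrK => /dW.
  rewrite addrK /vanishes_at.
  suff -> : homogeneous_part d (t *: v) =
    (fun m => homogeneous_part d v m * t ^+ m) by [].
  by apply/funext => m; exact: homogeneous_part_scale.
apply; rewrite in_fset_set; last exact: finite_mi_weight.
by rewrite inE.
Qed.

Lemma slices_independent (R : realType) (n : nat) (U V W : set 'rV[R]_n)
    (psi : 'rV[R]_n -> 'rV[R]_n -> R) (p : 'rV[R]_n)
    (c : multi_index n -> 'rV[R]_n -> R) (I : finType) (x : I -> 'rV[R]_n)
    (beta : I -> R) :
  taylor_expansion U V psi p c -> (forall i, U (x i)) ->
  open W -> W !=set0 -> W `<=` V ->
  (forall y, W y -> \sum_i beta i * psi (x i) y = 0) ->
  forall s, \sum_i beta i * c s (x i) = 0.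
Proof.
move=> taylor Ux oW W0 WV psi0.
apply: (homogeneous_series_eq0 (p := p) oW W0) => y Wy.
rewrite -[X in _ --> X](psi0 _ Wy).
have -> : series (homogeneous_part (fun s => \sum_i beta i * c s (x i)) (y - p)) =
    (fun N => \sum_i beta i * series (homogeneous_part (c^~ (x i)) (y - p)) N).
  apply/funext => N; rewrite /series /=.
  under [RHS]eq_bigr do rewrite big_distrr/=.
  rewrite exchange_big/=; apply: eq_bigr => m _.
  rewrite homogeneous_partE.
  under [RHS]eq_bigr do rewrite homogeneous_partE big_distrr/=.
  rewrite exchange_big/=; apply: eq_bigr => s _.
  by rewrite big_distrl/=; apply: eq_bigr => i _; rewrite mulrA.
apply: cvg_big => [|i _]; first exact: add_continuous.
apply: cvgMr; exact: (taylor _ _ (Ux i) (WV _ Wy)).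
Qed.

(** * Choosing the points *)

Lemma lebesgue_null0 (R : realType) (n : nat) : @lebesgue_null R n set0.
Proof.
move=> e e0; exists set0, (fun=> 0), (fun=> 0); split => //.
by rewrite esum_set0 lte_fin.
Qed.

(** The points are chosen one by one, so that the first r rows have rank at least
    r; replacing the remaining rows by zero keeps the matrices square. A new row
    increases the rank when it is not killed by a column of the cokernel of the
    previous ones. *)
Lemma exists_full_rank (F : fieldType) (T : Type) (k : nat)
    (W : 'I_k -> set T) (f : 'I_k -> T -> F) :
  (forall i (alpha : 'I_k -> F),
     (forall x, W i x -> \sum_j alpha j * f j x = 0) -> forall j, alpha j = 0) ->
  exists x : 'I_k -> T,
    (forall i, W i (x i)) /\ \rank (\matrix_(i, j) f j (x i)) = k.
Proof.
move=> indep.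
have /choice[x0 Wx0] : forall i, exists x, W i x.
  move=> i; apply: contrapT => W0.
  suff /eqP : (1 : F) = 0 by rewrite oner_eq0.
  by apply: (indep i (fun=> 1) _ i) => x Wx; case: W0; exists x.
pose M r (x : 'I_k -> T) : 'M[F]_k :=
  \matrix_(i, j) (if (i < r)%N then f j (x i) else 0).
have MS r x x' : (forall i : 'I_k, (i < r)%N -> x' i = x i) ->
    (M r x <= M r.+1 x')%MS.
  move=> xx'; apply/row_subP => i; have [ir|ri] := ltnP i r.
    suff -> : row i (M r x) = row i (M r.+1 x') by exact: row_sub.
    by apply/rowP => j; rewrite !mxE ir ltnS ltnW// xx'.
  suff -> : row i (M r x) = 0 by exact: sub0mx.
  by apply/rowP => j; rewrite !mxE ltnNge ri.
have grow r : (r <= k)%N ->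
    exists x, (forall i, W i (x i)) /\ (r <= \rank (M r x))%N.
  elim: r => [_|r IH rk]; first by exists x0.
  have [x [Wx rx]] := IH (ltnW rk).
  have [rx'|xr] := ltnP r (\rank (M r x)).
    by exists x; split => //; apply: leq_trans rx' (mxrankS (MS _ _ _ _)).
  have : cokermx (M r x) != 0.
    by rewrite -mxrank_eq0 mxrank_coker subn_eq0 -ltnNge (leq_ltn_trans xr).
  case/matrix0Pn => j1 [j0 cj].
  pose i0 := Ordinal rk.
  have [y Wy yN0] : exists2 y, W i0 y & 
      \sum_j cokermx (M r x) j j0 * f j y != 0.
    apply: contrapT => N; move/eqP: cj; apply.
    apply: (indep i0 (fun j => cokermx (M r x) j j0)) => y Wy.
    by apply/eqP; apply: contrapT => /negP ?; apply: N; exists y.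
  pose x' i := if i == i0 then y else x i.
  exists x'; split.
    by move=> i; rewrite /x'; case: eqVneq => [->|].
  apply: (leq_ltn_trans rx); rewrite rank_ltmx// ltmxE MS/=; last first.
    by move=> i ir; rewrite /x'; case: eqVneq => // ii0; rewrite ii0 ltnn in ir.
  rewrite submxE; apply: contra yN0 => /eqP/matrixP/(_ i0 j0).
  rewrite !mxE => M0; apply/eqP; rewrite -[RHS]M0; apply: eq_bigr => j _.
  by rewrite !mxE /= ltnS leqnn /x' eqxx mulrC.
have [x [Wx kx]] := grow k (leqnn k).
exists x; split => //; apply/eqP; rewrite eqn_leq rank_leq_row/=.
suff <- : M k x = \matrix_(i, j) f j (x i) by [].
by apply/matrixP => i j; rewrite !mxE ltn_ord.
Qed.

Theorem proposition2 (R : realType) (n : nat) (U V : set 'rV[R]_n)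
    (openU : open U) (openV : open V)
    (psi : 'rV[R]_n -> 'rV[R]_n -> R) (psi_smooth : smooth2 U V psi)
    (p : 'rV[R]_n) (Vp : V p) (c : multi_index n -> 'rV[R]_n -> R)
    (psi_taylor : taylor_expansion U V psi p c)
    (c_indep : forall k : nat, exists s : 'I_k -> multi_index n,
       injective s /\
       locally_linearly_independent U (fun i : 'I_k => c (s i))) :
  full_rank_ae U V psi.
Proof.
move=> k U_ V_ HU HV; split=> [x y _ _|]; first exact: rank_leq_row.
have [s [_ s_indep]] := c_indep k.
have [x [U_x rk_c]] : exists x : 'I_k -> 'rV[R]_n,
    (forall i, U_ i (x i)) /\ \rank (\matrix_(i, j) c (s j) (x i)) = k.
  apply: (exists_full_rank (f := fun j => c (s j))) => i alpha alpha0.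
  have [oW W0 WU] := HU i; apply: (s_indep _ oW W0 WU alpha).
  suff -> : U_ i `&` [set x | \sum_j alpha j * c (s j) x <> 0] = set0.
    exact: lebesgue_null0.
  by rewrite -subset0 => x [/alpha0].
have [y [V_y rk_psi]] : exists y : 'I_k -> 'rV[R]_n,
    (forall j, V_ j (y j)) /\ \rank (\matrix_(j, i) psi (x i) (y j)) = k.
  apply: (exists_full_rank (f := fun i => psi (x i))) => j beta beta0.
  have [oW W0 WV] := HV j.
  have Ux i : U (x i) by have [_ _] := HU i; apply; exact: U_x.
  have cb := slices_independent psi_taylor Ux oW W0 WV beta0.
  have rf : row_free (\matrix_(i, j) c (s j) (x i)) by rewrite /row_free rk_c.
  have /rowP b0 : \row_i beta i = 0.
    apply: (row_free_inj rf); rewrite mul0mx; apply/rowP => l.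
    by rewrite !mxE -[RHS](cb (s l)); apply: eq_bigr => i _; rewrite !mxE.
  by move=> i; have := b0 i; rewrite !mxE.
exists x, y; split=> //; rewrite -[RHS]rk_psi -mxrank_tr; congr (\rank _).
by apply/matrixP => i j; rewrite !mxE.
Qed.
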